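(* In the setting described in the context, for every $z_i\in D$ the Shapley value of $z_i$ with respect to $v$ satisfies $$\phi_{z_i}=\frac{2\,\mathbb{1}[y_i=y^{(\mathrm{val})}]-1}{N}\sum_{\ell=0}^{N-1}\binom{N-1}{\ell}^{-1}G_{i,\ell}.$$
   Context: Training set $D=\{z_1,\dots,z_N\}$, $z_i=(x_i,y_i)$, validation point $z^{(\mathrm{val})}=(x^{(\mathrm{val})},y^{(\mathrm{val})})$, points indexed so that $d(x_1,x^{(\mathrm{val})})\le\cdots\le d(x_N,x^{(\mathrm{val})})$. For $S\subseteq D$ and $1\le j\le|S|$, $\alpha(S,j)$ is the $j$-th smallest index of a point of $S$. Integer $K\ge1$; weights $w_j\in[0,1]$; signed weights $\widetilde w_j=w_j$ if $y_j=y^{(\mathrm{val})}$, $\widetilde w_j=-w_j$ otherwise. Utility $v(S)=\mathbb{1}[\sum_{j=1}^{\min(K,|S|)}\widetilde w_{\alpha(S,j)}\ge0]$ (empty sum $=0$). Shapley value: $\phi_{z}=\frac1N\sum_{k=1}^N\binom{N-1}{k-1}^{-1}\sum_{S\subseteq D\setminus\{z\},|S|=k-1}[v(S\cup\{z\})-v(S)]$. Conditions for $S\subseteq D\setminus\{z_i\}$: $\mathrm{Cond}_{KNN}$: $|\{z_j\in S:j<i\}|\le K-1$. $\mathrm{Cond}_{0\to1}$: if $|S|\le K-1$, $\sum_{z_j\in S}\widetilde w_j\in[-\widetilde w_i,0)$; if $|S|\ge K$, $\sum_{j=1}^{K-1}\widetilde w_{\alpha(S,j)}\in[-w_i,-\widetilde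 w_{\alpha(S,K)})$. $\mathrm{Cond}_{1\to0}$: if $|S|\le K-1$, $\sum_{z_j\in S}\widetilde w_j\in[0,-\widetilde w_i)$; if $|S|\ge K$, $\sum_{j=1}^{K-1}\widetilde w_{\alpha(S,j)}\in[-\widetilde w_{\alpha(S,K)},-\widetilde w_i)$. $G_{i,\ell}$ is the number of subsets $S\subseteq D\setminus\{z_i\}$ with $|S|=\ell$ satisfying $\mathrm{Cond}_{KNN}$ and, additionally, $\mathrm{Cond}_{0\to1}$ if $y_i=y^{(\mathrm{val})}$, or $\mathrm{Cond}_{1\to0}$ if $y_i\ne y^{(\mathrm{val})}$.
   Formalization: The formal theorem additionally assumes that the weights are nonincreasing in the index (w_j ≤ w_i whenever i ≤ j, so nearer points weigh at least as much); without this the formula fails, e.g. N=3, K=2, w=(1/2,1/10,9/10), only y_1 ≠ y^(val), i=2. *)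

(* Defs.v *)
From HB Require Import structures.
From mathcomp Require Import all_boot all_order all_algebra.

Set Implicit Arguments.
Unset Strict Implicit.
Unset Printing Implicit Defensive.

Import Order.TTheory GRing.Theory Num.Theory.
Local Open Scope ring_scope.

Definition shapley (R : realFieldType) (N : nat)
    (v : {set 'I_N} -> R) (i : 'I_N) : R :=
  N%:R^-1 * \sum_(1 <= k < N.+1)
    'C(N.-1, k.-1)%:R^-1 *
      \sum_(S : {set 'I_N} | (i \notin S) && (#|S| == k.-1))
        (v (i |: S) - v S).

(* A data point is represented by its index, so the point numbered j in
   1, ..., N is the ordinal j.-1, and sets of points are sets of ordinals. *)

(* [enum S] lists S in increasing order.  The rank j starts at 1; the value is
   [None] when j exceeds #|S|, and only 1 <= j <= #|S| is used below. *)
Definition alpha (N : nat) (S : {set 'I_N}) (j : nat) : option 'I_N :=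
  onth (enum S) j.-1.

Section WeightedKNN.

Variables (R : realFieldType) (Y : eqType) (N K : nat).
Variables (y : 'I_N -> Y) (yval : Y) (w : 'I_N -> R).

Definition sweight (j : 'I_N) : R := if y j == yval then w j else - w j.

(* The signed weight of the point alpha(S, j), for 1 <= j <= #|S|. *)
Definition sweight_alpha (S : {set 'I_N}) (j : nat) : R :=
  oapp sweight 0 (alpha S j).

Definition utility (S : {set 'I_N}) : R :=
  (0 <= \sum_(1 <= j < (minn K #|S|).+1) sweight_alpha S j)%R%:R.

Definition cond_KNN (i : 'I_N) (S : {set 'I_N}) : bool :=
  (#|[set j in S | (j < i)%N]| <= K - 1)%N.

Definition cond_01 (i : 'I_N) (S : {set 'I_N}) : bool :=
  if (#|S| <= K - 1)%N then
    \sum_(j in S) sweight j \in `[- sweight i, 0[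
  else
    \sum_(1 <= j < K) sweight_alpha S j \in `[- w i, - sweight_alpha S K[.

Definition cond_10 (i : 'I_N) (S : {set 'I_N}) : bool :=
  if (#|S| <= K - 1)%N then
    \sum_(j in S) sweight j \in `[0, - sweight i[
  else
    \sum_(1 <= j < K) sweight_alpha S j
      \in `[- sweight_alpha S K, - sweight i[.

Definition G (i : 'I_N) (l : nat) : nat :=
  #|[set S : {set 'I_N} |
      [&& i \notin S, #|S| == l, cond_KNN i S
        & if y i == yval then cond_01 i S else cond_10 i S]]|.

End WeightedKNN.

(* Main.v *)
(** Listing the points in increasing order, [S] reads [A ++ B] and [i |: S]
    reads [A ++ i :: B], where [A] collects the points of [S] before [i].  If
    [A] has at least [K] points, adding [i] does not change the [K] nearest
    neighbours.  Otherwise, [i] is added to the neighbours when [#|S| < K], and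
    replaces the [K]-th point of [S] when [K <= #|S|].  In the latter case that
    point lies after [i], so its weight is at most [w i]; hence the marginal
    contribution of [i] always has the sign determined by its label, and it is
    nonzero exactly under the condition counted by [G]. *)
Require Import Defs.
From mathcomp Require Import all_boot all_order all_algebra.
From mathcomp Require Import zify lra.
Import Order.TTheory GRing.Theory Num.Theory.
Local Open Scope ring_scope.

(** Ranks past the end of [s] contribute the default 0, just as [take] stops there, so [n] needs no
    bound. *)
Lemma sum_onth_take (V : nmodType) (T : Type) (f : T -> V) (s : seq T) (n : nat) :
  \sum_(1 <= j < n.+1) oapp f 0 (onth s j.-1) = \sum_(j <- take n s) f j.
Proof.
rewrite big_add1 /=; elim: s n => [|a s IHs] n.
  by rewrite big_nil big1 // => -[].
case: n => [|n]; first by rewrite big_geq // big_nil.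
by rewrite big_nat_recl //= big_cons -IHs.
Qed.

Lemma sorted_enum_ord_set (N : nat) (S : {set 'I_N}) :
  sorted (relpre val ltn) (enum S).
Proof.
rewrite [enum S]/enum_mem -enumT.
apply: sorted_filter; first by move=> a b c /=; apply: ltn_trans.
by rewrite -sorted_map val_enum_ord iota_ltn_sorted.
Qed.

(** A strictly increasing list is determined by its elements. *)
Lemma eq_enum_ord_set (N : nat) (S : {set 'I_N}) (s : seq 'I_N) :
  sorted (relpre val ltn) s -> s =i S -> enum S = s.
Proof.
move=> s_sorted sS; apply: (irr_sorted_eq (leT := relpre val ltn)) => //.
- by move=> a b c /=; apply: ltn_trans.
- by move=> a /=; rewrite ltnn.
- exact: sorted_enum_ord_set.
- by move=> j; rewrite mem_enum sS.
Qed.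

Section SplitAt.

Variables (N : nat) (i : 'I_N) (S : {set 'I_N}).
Hypothesis iNS : i \notin S.

Let below := enum [set j in S | (j < i)%N].
Let above := enum [set j in S | (i < j)%N].

Let below_lt j : j \in below -> (j < i)%N.
Proof. by rewrite mem_enum inE => /andP[]. Qed.

Let above_gt j : j \in above -> (i < j)%N.
Proof. by rewrite mem_enum inE => /andP[]. Qed.

Let sorted_below_above : sorted (relpre val ltn) (below ++ i :: above).
Proof.
rewrite sorted_pairwise; last by move=> a b c /=; apply: ltn_trans.
rewrite pairwise_cat /= -!sorted_pairwise; do ?by move=> a b c /=; apply: ltn_trans.
rewrite !sorted_enum_ord_set !andbT /=; apply/andP; split; last first.
  by apply/allP => j /above_gt.
apply/allrelP => a b /below_lt lt_ai; rewrite inE => /predU1P[-> //|/above_gt].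
exact: ltn_trans.
Qed.

Lemma enum_setU1_split : enum (i |: S) = below ++ i :: above.
Proof.
apply: eq_enum_ord_set => // j.
rewrite mem_cat inE !mem_enum !inE -val_eqE /=.
by case: ltngtP => //=; rewrite ?andbT ?andbF ?orbF.
Qed.

Lemma enum_set_split : enum S = below ++ above.
Proof.
apply: eq_enum_ord_set => [|j].
  apply: subseq_sorted sorted_below_above.
    by move=> a b c /=; apply: ltn_trans.
  by rewrite cat_subseq // subseq_cons.
rewrite mem_cat !mem_enum !inE; case: ltngtP => [||/val_inj ->];
  by rewrite ?andbT ?andbF ?orbF // (negPf iNS).
Qed.

End SplitAt.

(** Used with [a] the sum over the neighbours common to [S] and [i |: S], while [s] and [t] are the
    signed weights being exchanged. *)
Lemma indicator_ge0_sub (R : realFieldType) (a s t : R) : t <= s ->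
  (0 <= a + s)%R%:R - (0 <= a + t)%R%:R = (a \in `[- s, - t[)%:R :> R.
Proof.
rewrite in_itv /= => le_ts.
by case: (leP 0 (a + s)); case: (leP 0 (a + t)); case: (leP (- s) a);
  case: (ltP a (- t)) => /= *; lra.
Qed.

Section MarginalContribution.

Variables (R : realFieldType) (Y : eqType) (N K : nat).
Variables (y : 'I_N -> Y) (yval : Y) (w : 'I_N -> R).

Let sw := sweight y yval w.
Let knn_sum n S := \sum_(j <- take n (enum (S : {set 'I_N}))) sw j.

Lemma utilityE (S : {set 'I_N}) :
  utility K y yval w S = (0 <= knn_sum K S)%R%:R.
Proof.
rewrite /utility /sweight_alpha /alpha sum_onth_take -/sw /knn_sum.
case: (leqP K #|S|) => [//|/ltnW le_SK].
by rewrite !take_oversize // -cardE.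
Qed.

Hypothesis K_ge1 : (1 <= K)%N.
Hypothesis w_ge0 : forall j, 0 <= w j.
Hypothesis w_nonincreasing : forall i j : 'I_N, (i <= j)%N -> w j <= w i.

Lemma marginal_utility (i : 'I_N) (S : {set 'I_N}) : i \notin S ->
  utility K y yval w (i |: S) - utility K y yval w S =
  (2 * (y i == yval)%:R - 1) *
  (cond_KNN K i S && if y i == yval then cond_01 K y yval w i S
                     else cond_10 K y yval w i S)%:R.
Proof.
move=> iNS; rewrite !utilityE /cond_KNN /knn_sum.
rewrite enum_setU1_split //.
set A : seq 'I_N := enum [set j in S | (j < i)%N].
set B : seq 'I_N := enum [set j in S | (i < j)%N].
have SAB : enum S = A ++ B by exact: enum_set_split.
have cA : #|[set j in S | (j < i)%N]| = size A by rewrite cardE.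
have cS : #|S| = (size A + size B)%N by rewrite cardE SAB size_cat.
rewrite SAB cA.
have [leA|ltA] /= := leqP (size A) (K - 1); last first.
  by rewrite mulr0 !takel_cat ?subrr //; lia.
have swi : sw i = if y i == yval then w i else - w i by [].
have wi := w_ge0 i.
rewrite /cond_01 /cond_10 -/sw -!(big_enum _ _ _ sw) /= SAB cS.
case: leqP => [leS|ltS].
  rewrite !take_oversize ?size_cat /=; try lia.
  rewrite -cat_rcons -cats1 !big_cat big_seq1 /= -/sw.
  set a := \sum_(j <- A) _; set b := \sum_(j <- B) _.
  (* No point is displaced here: the inserted 0 stands for its weight. *)
  rewrite addrAC -[in X in _ - X](addr0 (a + b)) swi.
  case: (y i == yval) => /=; first by rewrite indicator_ge0_sub // oppr0; lra.
  (* With differing labels [i] carries the smaller weight, so the difference is reversed; this gives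
     the sign -1. *)
  rewrite -opprB indicator_ge0_sub ?oppr0; lra.
(* Of the [K - 1] nearest points of [S], [n] lie in [B]; the displaced point is thus entry [n] of
   [B], counted from 0. *)
have [n Kn] : exists n, K = (size A + n).+1.
  by exists (K - 1 - size A)%N; lia.
have nB : (n < size B)%N by lia.
case: K Kn K_ge1 ltS leA => // K' [KE] _ _ _.
rewrite /sweight_alpha /alpha sum_onth_take /= SAB.
have onthK : onth (A ++ B) K' = Some (nth i B n).
  by rewrite onthE (nth_map i) ?size_cat ?KE ?ltn_add2l // nth_cat ltnNge
    leq_addr addKn.
set k := nth i B n in onthK.
have ik : (i < k)%N.
  by have := mem_nth i nB; rewrite mem_enum inE => /andP[].
have wk := w_ge0 k; have wki := w_nonincreasing _ _ (ltnW ik).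
have swk : sw k = if y k == yval then w k else - w k by [].
rewrite onthK /= -/sw KE !take_cat.
have -> : ((size A + n).+1 < size A)%N = false by lia.
have -> : (size A + n < size A)%N = false by lia.
(* Both neighbour lists contain [A] and [take n B]; they differ only by [i] against [k]. *)
rewrite subSn ?leq_addr // addKn /= (take_nth i) // -/k.
rewrite -cats1 !big_cat big_cons big_seq1 /= -/sw.
set a := \sum_(j <- A) _; set b := \sum_(j <- take n B) _.
(* The upper bound serves when the label of [i] agrees with [yval], the lower one when it
   differs. *)
have {swk} swk : - w i <= sw k <= w i by rewrite swk; case: ifP => _; lra.
have -> : a + (sw i + b) = a + b + sw i by lra.
rewrite addrA swi; case: (y i == yval) => /=.
  by rewrite indicator_ge0_sub; lra.
by rewrite -opprB indicator_ge0_sub; lra.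
Qed.

End MarginalContribution.

Theorem theorem2 (R : realFieldType) (X : Type) (Y : eqType) (N K : nat)
    (d : X -> X -> R) (x : 'I_N -> X) (y : 'I_N -> Y) (xval : X) (yval : Y)
    (w : 'I_N -> R)
    (K_ge1 : (1 <= K)%N)
    (sorted_dist : forall i j : 'I_N, (i <= j)%N ->
       d (x i) xval <= d (x j) xval)
    (w_bound : forall j : 'I_N, 0 <= w j <= 1)
    (w_nonincreasing : forall i j : 'I_N, (i <= j)%N -> w j <= w i)
    (i : 'I_N) :
  shapley (utility K y yval w) i =
    (2 * (y i == yval)%:R - 1) / N%:R *
      \sum_(0 <= l < N) 'C(N.-1, l)%:R^-1 * (G K y yval w i l)%:R.
Proof.
have w_ge0 j : 0 <= w j by case/andP: (w_bound j).
rewrite /shapley big_add1 /= [_ / _]mulrC -mulrA; congr (_ * _).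
rewrite mulr_sumr; apply: eq_bigr => l _; rewrite mulrCA; congr (_ * _).
under eq_bigr => S /andP[iNS _] do rewrite marginal_utility //.
(* The sign does not depend on [S], so the remaining sum of indicators is a cardinality. *)
rewrite -mulr_sumr -natr_sum -big_mkcondr sum1_card /G; congr (_ * _%:R).
by rewrite cardsE; apply: eq_card => S; rewrite unfold_in /= -andbA.
Qed.
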